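(* For every integer $t\ge 0$ and every $\varepsilon>0$ there exists $N>0$ such that for every $n>N$ the following holds. Let $H$ be an $F_5^{t}$-free $3$-graph on vertex set $[n]$ with $|H|\ge s^\circ_t(n)$, and let $\pi=(V_1,V_2,V_3)$ be a partition of $[n]$ maximizing $|H_\pi|$. Then $|\bar H_\pi|\le(\frac19+\varepsilon)tn^2$.
   Context: A $3$-graph is a $3$-uniform hypergraph, identified with its set of hyperedges. For an integer $t\ge 0$, $F_5^{t}$ is the $3$-graph on vertex set $\{1,\dots,5+t\}$ with hyperedges $\{1,2,3\},\{1,2,4\}$ and $\{3,4,k\}$ for $5\le k\le 5+t$. $\mathrm{ex}(m,F_2^t)$ is the maximum number of hyperedges of an $m$-vertex $3$-graph in which every pair of vertices lies in at most $t$ hyperedges, and $s^\circ_t(n)=\lfloor \tfrac n3\rfloor\lfloor \tfrac{n+1}3\rfloor\lfloor \tfrac{n+2}3\rfloor+\mathrm{ex}(\lfloor \tfrac n3\rfloor,F_2^t)+\mathrm{ex}(\lfloor \tfrac{n+1}3\rfloor,F_2^t)+\mathrm{ex}(\lfloor \tfrac{n+2}3\rfloor,F_2^t)$. For a partition $\pi=(V_1,V_2,V_3)$ of $[n]$, $K_\pi$ is the set of triples with exactly one vertex in each $V_i$, $H_\pi=H\cap K_\pi$, and $\bar H_\pi=K_\pi\setminus H_\pi$. *)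

(* Defs.v *)
From mathcomp Require Import all_boot.

Set Implicit Arguments.
Unset Strict Implicit.
Unset Printing Implicit Defensive.

Definition is_3graph (T : finType) (H : {set {set T}}) : bool :=
  [forall e in H, #|e| == 3].

(* [H] contains a copy of [F] as a (not necessarily induced) subgraph. *)
Definition contains_copy (S T : finType)
    (F : {set {set S}}) (H : {set {set T}}) : Prop :=
  exists f : S -> T,
    injective f /\ forall e : {set S}, e \in F -> f @: e \in H.

Definition free_of (S T : finType)
    (F : {set {set S}}) (H : {set {set T}}) : Prop :=
  ~ contains_copy F H.

(* The vertices 1, ..., 5 + t are numbered from 0 here, so that the
   hyperedges are 012, 013 and 23k for 4 <= k <= 4 + t. *)
Definition F5 (t : nat) : {set {set 'I_(4 + t).+1}} :=
  [set [set inord 0; inord 1; inord 2]; [set inord 0; inord 1; inord 3]]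
  :|: [set [set inord 2; inord 3; k] | k : 'I_(4 + t).+1 & 4 <= k].

Definition codegree (T : finType) (G : {set {set T}}) (x y : T) : nat :=
  #|[set e in G | (x \in e) && (y \in e)]|.

(* ex(m, F_2^t) *)
Definition exF2 (m t : nat) : nat :=
  \max_(G : {set {set 'I_m}} |
          is_3graph G && [forall x, forall y, (x != y) ==> (codegree G x y <= t)])
     #|G|.

Definition s_circ (t n : nat) : nat :=
  (n %/ 3) * (n.+1 %/ 3) * (n.+2 %/ 3)
  + exF2 (n %/ 3) t + exF2 (n.+1 %/ 3) t + exF2 (n.+2 %/ 3) t.

(* Ordered partitions into three parts; parts may be empty. *)
Definition is_partition3 (T : finType) (V : 'I_3 -> {set T}) : Prop :=
  (forall i j, i != j -> [disjoint V i & V j]) /\ \bigcup_i V i = [set: T].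

Definition K_of (T : finType) (V : 'I_3 -> {set T}) : {set {set T}} :=
  [set e : {set T} | (#|e| == 3) && [forall i, #|e :&: V i| == 1]].

Definition H_of (T : finType) (H : {set {set T}}) (V : 'I_3 -> {set T}) :
    {set {set T}} :=
  H :&: K_of V.

Definition Hbar_of (T : finType) (H : {set {set T}}) (V : 'I_3 -> {set T}) :
    {set {set T}} :=
  K_of V :\: H_of H V.

Definition maximizing_partition (T : finType)
    (H : {set {set T}}) (V : 'I_3 -> {set T}) : Prop :=
  is_partition3 V /\
  forall W : 'I_3 -> {set T}, is_partition3 W -> #|H_of H W| <= #|H_of H V|.

(* Main.v *)
Require Import Defs.
From mathcomp Require Import all_boot all_order all_algebra.
From mathcomp Require Import reals.
From mathcomp Require Import zify ring lra.

(** Delete from [H] all edges through a pair of codegree at most [t + 2]: only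
    O(n^2) edges are lost and the rest is cancellative, because [abc, abd] in
    an F_5^t-free [H] force the codegree of [cd] to be at most [t + 2]. A
    cancellative 3-graph with n^3/27 - O(n^2) edges has an edge [xyz] whose
    three link neighbourhoods N(xy), N(xz), N(yz), which are disjoint and
    independent in the shadow, cover all but O(sqrt n) vertices; hence
    Hbar = o(n^3).

    If B is the set of edges of [H] outside K_pi, then |H| >= s°_t(n) yields
    |Hbar| <= |B| - 3 ex(n/3, F_2^t) <= |B| - t n^2/18 + O(n). Two vertices
    of the same part that miss few crossing triples have codegree at most [t],
    so at most (t/2) sum_i |V_i|^2, about t n^2/6, edges of B contain such a
    pair. Every other edge of B contains one of the o(n) vertices missing a
    positive proportion of their crossing triples; by the maximality of pi each
    of these lies in o(n^2) such edges, so that there are o(|Hbar|) of them. *)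

Set Implicit Arguments.
Unset Strict Implicit.
Unset Printing Implicit Defensive.

(** * Counting ordered triples *)

Definition nbr (T : finType) (H : {set {set T}}) (x y : T) : {set T} :=
  [set z | [set x; y; z] \in H].

Section Triples.
Variable T : finType.
Implicit Types (H F : {set {set T}}) (x y z a b c d : T) (e : {set T}).

Lemma set3C12 x y z : [set x; y; z] = [set y; x; z].
Proof. by rewrite (setUC [set x]). Qed.

Lemma set3C23 x y z : [set x; y; z] = [set x; z; y].
Proof. by rewrite setUAC. Qed.

Lemma set3C13 x y z : [set x; y; z] = [set z; y; x].
Proof. by rewrite set3C23 set3C12 set3C23. Qed.

Lemma edge_card H e : is_3graph H -> e \in H -> #|e| = 3.
Proof. by move=> /forall_inP H3 /H3 /eqP. Qed.

Lemma cards3_neq x y z : #|[set x; y; z]| = 3 -> [/\ x != y, x != z & y != z].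
Proof.
move=> h; split; apply/eqP => exy; move: h; rewrite exy ?setUid.
- by rewrite cards2; case: (_ != _).
- by rewrite setUAC setUid cards2; case: (_ != _).
- by rewrite -setUA setUid cards2; case: (_ != _).
Qed.

Lemma edge_neq H x y z :
  is_3graph H -> [set x; y; z] \in H -> [/\ x != y, x != z & y != z].
Proof. by move=> H3 /(edge_card H3) /cards3_neq. Qed.

Lemma set3_eqE e x y z : #|e| = 3 ->
  ([set x; y; z] == e) = [&& x \in e, y \in e :\ x & z \in e :\ x :\ y].
Proof.
move=> e3; apply/eqP/idP => [ee | /and3P [xe ye ze]].
  have := e3; rewrite -ee => /cards3_neq [xy xz yz].
  by rewrite !inE !eqxx ![y == x]eq_sym ![z == _]eq_sym xy xz yz !orbT.
apply/eqP; rewrite eqEcard e3; move: ye ze; rewrite !inE => /andP [yx ye] /and3P [zy zx ze].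
apply/andP; split.
  by apply/subsetP => u; rewrite !inE => /orP [/orP [] |] /eqP ->.
by rewrite setUC cardsU1 cards2 !inE negb_or zx zy (eq_sym x) yx.
Qed.

Lemma sum_pairs_edge e x : #|e| = 3 ->
  \sum_y \sum_z ([set x; y; z] == e) = 2 * (x \in e).
Proof.
move=> e3.
under eq_bigr => y _ do under eq_bigr => z _ do rewrite (set3_eqE _ _ _ e3).
case xe: (x \in e) => /=; last first.
  by rewrite big1 // => y _; rewrite big1.
have c2 : #|e :\ x| = 2 by move: (cardsD1 x e); rewrite xe e3 => -[].
rewrite (bigID (fun y => y \in e :\ x)) /= [X in _ + X]big1 ?addn0; last first.
  by move=> y /negbTE ->; rewrite big1.
transitivity (\sum_(y in e :\ x) 1); last by rewrite sum1_card c2.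
apply: eq_bigr => y ye.
rewrite ye /=.
rewrite (eq_bigr (fun z => if z \in e :\ x :\ y then 1 else 0)); last by move=> z _; case: ifP.
rewrite -big_mkcond sum1_card.
by move: (cardsD1 y (e :\ x)); rewrite ye c2 => -[].
Qed.

Lemma sum_pairs H x : is_3graph H ->
  \sum_y \sum_z ([set x; y; z] \in H) = 2 * #|[set e in H | x \in e]|.
Proof.
move=> H3.
transitivity (\sum_(e in H) \sum_y \sum_z ([set x; y; z] == e)).
  rewrite [RHS]exchange_big; apply: eq_bigr => y _ /=.
  rewrite [RHS]exchange_big; apply: eq_bigr => z _ /=.
  case h: (_ \in H).
    rewrite (bigD1 _ h) /= eqxx big1 ?addn0 // => e /andP [_ ne].
    by rewrite eq_sym (negbTE ne).
  by rewrite big1 // => e eH; case: eqP => // ee; rewrite ee eH in h.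
rewrite (eq_bigr (fun e => 2 * (x \in e))); last first.
  by move=> e eH; rewrite sum_pairs_edge // (edge_card H3).
rewrite -big_distrr /= -sum1_card big_mkcond [in RHS]big_mkcond /=.
congr (2 * _); apply: eq_bigr => e _; rewrite !inE.
by case: (e \in H); case: (x \in e).
Qed.

(** Each edge is counted once for each of its 6 orderings, and triples with a repeated entry
    contribute nothing because edges have three elements. Cardinalities can thus be compared term by
    term over ordered triples. *)
Lemma sum_triples H : is_3graph H ->
  \sum_x \sum_y \sum_z ([set x; y; z] \in H) = 6 * #|H|.
Proof.
move=> H3.
under eq_bigr => x _ do rewrite sum_pairs //.
rewrite -big_distrr /=.
have -> : \sum_x #|[set e in H | x \in e]| = 3 * #|H|; last by rewrite mulnA.
under eq_bigr => x _ do rewrite -sum1_card big_mkcond /=.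
rewrite exchange_big /= mulnC -sum_nat_const [RHS]big_mkcond /=.
apply: eq_bigr => e _; case: ifP => eH.
  rewrite -(edge_card H3 eH) -sum1_card [RHS]big_mkcond /=.
  by apply: eq_bigr => x _; rewrite !inE eH.
by rewrite big1 // => x _; rewrite inE eH.
Qed.

End Triples.

(** * Reduction to cancellative 3-graphs *)

Section F5free.
Variables (T : finType) (t : nat).
Implicit Types (H G : {set {set T}}) (x y z a b c d : T).

(** If [K] avoided a and b, then a, b, c, d followed by t + 1 elements of [K] would span a copy of
    [F5 t]; c and d lie outside [K] since the edges cdk have three distinct vertices. *)
Lemma F5_free_hit H a b c d (K : {set T}) :
  is_3graph H -> free_of (F5 t) H ->
  [set a; b; c] \in H -> [set a; b; d] \in H -> c != d ->
  K \subset nbr H c d -> t < #|K| -> (a \in K) || (b \in K).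
Proof.
move=> H3 Hf abc abd cd /subsetP sK tK; apply: contraT; rewrite negb_or => /andP [aK bK].
case: Hf.
have [ab ac bc] := edge_neq H3 abc.
have [_ ad bd] := edge_neq H3 abd.
have cK : c \notin K.
  by apply/negP => /sK; rewrite inE => /(edge_neq H3) []; rewrite eqxx.
have dK : d \notin K.
  by apply/negP => /sK; rewrite inE => /(edge_neq H3) []; rewrite eqxx.
pose s := [:: a, b, c, d & enum K].
have us : uniq s.
  by rewrite /= !inE !mem_enum !negb_or ab ac ad bc bd cd aK bK cK dK enum_uniq.
have szs : (4 + t).+1 <= size s by rewrite /= -cardE; move: tK; clear; lia.
exists (fun i : 'I_(4 + t).+1 => nth a s i); split.
  move=> i j /eqP; rewrite nth_uniq //; last 2 first.
  - exact: leq_trans (ltn_ord i) szs.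
  - exact: leq_trans (ltn_ord j) szs.
  by move/eqP/val_inj.
have i0 k : k <= 4 -> (inord k : 'I_(4 + t).+1) = k :> nat.
  by move=> k4; rewrite inordK //; move: k4; clear; lia.
move=> e; rewrite /F5 !inE => /orP [/orP [] /eqP -> | /imsetP [k]].
- by rewrite !imsetU !imset_set1 !i0.
- by rewrite !imsetU !imset_set1 !i0.
rewrite inE => k4 ->; rewrite !imsetU !imset_set1 !i0 //=.
case: k k4 => -[|[|[|[|k]]]] //= hk _.
have : nth a (enum K) k \in nbr H c d.
  by apply: sK; rewrite -mem_enum mem_nth // -cardE; move: hk tK; clear; lia.
by rewrite inE.
Qed.

(** Once a and b are removed from N(cd), [F5_free_hit] leaves room for at most t further
    vertices. *)
Lemma F5_free_nbr H a b c d :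
  is_3graph H -> free_of (F5 t) H ->
  [set a; b; c] \in H -> [set a; b; d] \in H -> c != d ->
  #|nbr H c d| <= t.+2.
Proof.
move=> H3 Hf abc abd cd; rewrite leqNgt; apply/negP => lt.
have := @F5_free_hit H a b c d (nbr H c d :\ a :\ b) H3 Hf abc abd cd.
rewrite !inE !eqxx /= andbF => h; suff: false by []; apply: h.
  by apply: subset_trans (subsetDl _ _) (subsetDl _ _).
have := cardsD1 a (nbr H c d); have := cardsD1 b (nbr H c d :\ a).
by do 2!case: (_ \in _); lia.
Qed.

Lemma nbrC H x y : nbr H x y = nbr H y x.
Proof. by apply/setP => z; rewrite !inE set3C12. Qed.

Lemma nbrxx H x : is_3graph H -> nbr H x x = set0.
Proof.
move=> H3; apply/setP => z; rewrite !inE; apply/negP => /(edge_neq H3) [].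
by rewrite eqxx.
Qed.

(* Maximising |G| + (m + 1) |{(x, y) : codegree 0}|: removing the at most [m]
   edges through a pair of small positive codegree would increase it. *)
Lemma regularize H m : is_3graph H ->
  exists G : {set {set T}}, [/\ G \subset H,
    forall x y, nbr G x y = set0 \/ m < #|nbr G x y|
    & #|H| <= #|G| + m.+1 * #|T| ^ 2].
Proof.
move=> H3.
pose Z G := [set p : T * T | nbr G p.1 p.2 == set0].
pose f (G : {set {set T}}) := #|G| + m.+1 * #|Z G|.
have [G GH Gmax] : exists2 G : {set {set T}}, G \subset H &
    forall G' : {set {set T}}, G' \subset H -> f G' <= f G.
  case: (@arg_maxnP _ H (fun G : {set {set T}} => G \subset H) f) => // G GH h.
  by exists G.
exists G; split=> //; last first.
  have := Gmax _ (subxx H); rewrite /f => h; apply: leq_trans (leq_addr (m.+1 * #|Z H|) _) _.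
  apply: leq_trans h _; rewrite leq_add2l leq_mul2l /=.
  by rewrite -mulnn -card_prod max_card.
move=> x y; case: (eqVneq (nbr G x y) set0) => [->|n0]; first by left.
right; rewrite ltnNge; apply/negP => le.
pose D := [set [set x; y; z] | z in nbr G x y].
have cD : #|D| <= m by apply: leq_trans (leq_imset_card _ _) le.
pose G' := G :\: D.
have G'G : G' \subset G by apply: subsetDl.
have := Gmax G' (subset_trans G'G GH); rewrite /f leqNgt => /negP; apply.
have ZZ : (x, y) |: Z G \subset Z G'.
  apply/subsetP => -[u v]; rewrite !inE /= => /orP [/eqP [-> ->] | /eqP uv0].
    apply/eqP/setP => z; rewrite !inE; apply/negP => /andP [/negP nD zG]; apply: nD.
    by apply/imsetP; exists z; rewrite ?inE.
  rewrite -subset0 -uv0; apply/subsetP => z; rewrite !inE.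
  by case/andP.
have := subset_leq_card ZZ; rewrite cardsU1 inE /= n0 /= => cZ.
have : #|G| <= #|G'| + #|D|.
  by rewrite -(cardsID D G) addnC leq_add2l subset_leq_card // subsetIr.
have := leq_mul (leqnn m.+1) cZ; rewrite mulnDr muln1; move: cD; clear.
by move: (m.+1 * _) (m.+1 * _) #|D| #|G| #|G'| => u v k g g'; lia.
Qed.

Lemma F5_free_cancellative H : is_3graph H -> free_of (F5 t) H ->
  exists G : {set {set T}}, [/\ G \subset H, is_3graph G,
    forall a b c d, [set a; b; c] \in G -> [set a; b; d] \in G -> nbr G c d = set0
    & #|H| <= #|G| + t.+3 * #|T| ^ 2].
Proof.
move=> H3 Hf; have [G [GH hG cG]] := regularize t.+2 H3.
have G3 : is_3graph G.
  by apply/forall_inP => e /(subsetP GH) /(forall_inP H3).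
exists G; split=> // a b c d abc abd.
case: (eqVneq c d) => [->|cd]; first exact: nbrxx.
case: (hG c d) => //; rewrite ltnNge => /negP []; apply: leq_trans (F5_free_nbr H3 Hf _ _ cd).
- by apply: subset_leq_card; apply/subsetP => z; rewrite !inE; apply: (subsetP GH).
- exact: (subsetP GH) abc.
- exact: (subsetP GH) abd.
Qed.

End F5free.

(** * Stability of cancellative 3-graphs *)

Section Cancellative.
Variables (T : finType) (G : {set {set T}}).
Hypothesis G3 : is_3graph G.
Hypothesis Gc : forall a b c d,
  [set a; b; c] \in G -> [set a; b; d] \in G -> nbr G c d = set0.

Local Notation d x y := #|nbr G x y|.
Local Notation s x y z := (d x y + d x z + d y z).

Lemma card_nbrE x y : d x y = \sum_z ([set x; y; z] \in G).
Proof.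
rewrite -sum1_card big_mkcond; apply: eq_bigr => z _; rewrite inE.
by case: (_ \in G).
Qed.

(** A common element v would give edges xvy and xvz, so cancellativity would empty N(yz), which
    contains x. *)
Lemma nbr_disjoint x y z : [set x; y; z] \in G -> [disjoint nbr G x y & nbr G x z].
Proof.
move=> xyz; rewrite -setI_eq0; apply/eqP/setP => v; rewrite !inE.
apply/negP => /andP [xyv xzv].
rewrite set3C23 in xyv; rewrite set3C23 in xzv.
have := Gc xyv xzv => /setP /(_ x); rewrite !inE.
by rewrite set3C23 set3C12 xyz.
Qed.

Lemma nbr_disjoint3 x y z : [set x; y; z] \in G ->
  [/\ [disjoint nbr G x y & nbr G x z], [disjoint nbr G x y & nbr G y z]
    & [disjoint nbr G x z & nbr G y z]].
Proof.
move=> xyz; split; first exact: nbr_disjoint.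
- by rewrite (nbrC _ x); apply: nbr_disjoint; rewrite set3C12.
- rewrite (nbrC _ x) (nbrC _ y); apply: nbr_disjoint.
  by rewrite set3C23 set3C13.
Qed.

Lemma card_nbr3 x y z : [set x; y; z] \in G ->
  #|nbr G x y :|: nbr G x z :|: nbr G y z| = s x y z.
Proof.
move=> /nbr_disjoint3 [d1 d2 d3].
rewrite cardsU setIUl !(disjoint_setI0 d1, disjoint_setI0 d2, disjoint_setI0 d3).
by rewrite setU0 cards0 subn0 cardsU (disjoint_setI0 d1) cards0 subn0.
Qed.

Lemma nbr_indep a b c e : c \in nbr G a b -> e \in nbr G a b -> d c e = 0.
Proof. by rewrite !inE => h1 h2; rewrite (Gc h1 h2) cards0. Qed.

(** The three neighbourhoods are disjoint, and ordered pairs inside one of them have codegree 0; the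
    factor 3 comes from Cauchy-Schwarz. *)
Lemma nonadjacent_pairs x y z : [set x; y; z] \in G ->
  s x y z ^ 2 <= 3 * \sum_u \sum_v (d u v == 0).
Proof.
move=> xyz; have [d1 d2 d3] := nbr_disjoint3 xyz.
have sq a b : \sum_u \sum_v ((u \in nbr G a b) && (v \in nbr G a b)) = d a b ^ 2.
  transitivity (\sum_(u in nbr G a b) \sum_(v in nbr G a b) 1).
    rewrite [RHS]big_mkcond; apply: eq_bigr => u _; case: ifP => _.
      by rewrite [RHS]big_mkcond; apply: eq_bigr => v _; case: ifP.
    by rewrite big1.
  by rewrite sum_nat_const sum1_card mulnn.
have : d x y ^ 2 + d x z ^ 2 + d y z ^ 2 <= \sum_u \sum_v (d u v == 0).
  rewrite -!sq -!big_split; apply: leq_sum => u _ /=.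
  rewrite -!big_split; apply: leq_sum => v _ /=.
  case: (eqVneq (d u v) 0) => [_|uv].
    have := disjointFr d1 (x := u); have := disjointFr d2 (x := u).
    have := disjointFr d3 (x := u).
    case: (u \in nbr G x y); case: (u \in nbr G x z); case: (u \in nbr G y z) => h1 h2 h3;
    rewrite ?addn0 ?add0n ?leq_b1 //;
    by [move: (h1 isT) | move: (h2 isT) | move: (h3 isT)].
  have no a b : (u \in nbr G a b) && (v \in nbr G a b) = false.
    by apply/negP => /andP [h1 h2]; rewrite (nbr_indep h1 h2) in uv.
  by rewrite !no.
move: (\sum_u _) (d x y) (d x z) (d y z) => Z i j k h.
have := (nat_Cauchy i j).1; have := (nat_Cauchy i k).1; have := (nat_Cauchy j k).1.
by move: h; rewrite !sqrnD !(mulnDl, mulnDr); lia.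
Qed.

Lemma sum_edge_weights :
  \sum_x \sum_y \sum_z ([set x; y; z] \in G) * s x y z =
  3 * \sum_x \sum_y d x y ^ 2.
Proof.
have h1 : \sum_x \sum_y \sum_z ([set x; y; z] \in G) * d x y = \sum_x \sum_y d x y ^ 2.
  apply: eq_bigr => x _; apply: eq_bigr => y _.
  by rewrite -big_distrl /= -card_nbrE mulnn.
have h2 : \sum_x \sum_y \sum_z ([set x; y; z] \in G) * d x z = \sum_x \sum_y d x y ^ 2.
  rewrite -h1; apply: eq_bigr => x _; rewrite exchange_big; apply: eq_bigr => y _.
  by apply: eq_bigr => z _; rewrite set3C23.
have h3 : \sum_x \sum_y \sum_z ([set x; y; z] \in G) * d y z = \sum_x \sum_y d x y ^ 2.
  rewrite -h2 exchange_big; apply: eq_bigr => x _; apply: eq_bigr => y _.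
  by apply: eq_bigr => z _; rewrite set3C12.
transitivity (\sum_x \sum_y \sum_z ([set x; y; z] \in G) * d x y
  + \sum_x \sum_y \sum_z ([set x; y; z] \in G) * d x z
  + \sum_x \sum_y \sum_z ([set x; y; z] \in G) * d y z); last first.
  by rewrite h1 h2 h3 !mulSn mul0n addn0 addnA.
rewrite -!big_split; apply: eq_bigr => x _; rewrite -!big_split; apply: eq_bigr => y _.
by rewrite -!big_split; apply: eq_bigr => z _ /=; rewrite !mulnDr.
Qed.

(* With s = n - l the largest weight of an edge, P the number of ordered pairs
   of positive codegree and e = 6|G|, summing (3d - n)^2 >= 0 over these pairs
   gives 6ne <= 3se + n^2 P, while 3P <= 3n^2 - s^2. *)
Lemma cancellative_stability : exists (c : T -> 'I_3) (L : {set T}),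
  (forall u v w, [set u; v; w] \in G -> u \notin L -> v \notin L -> c u != c v) /\
  #|L| ^ 2 * #|T| ^ 2 + 54 * #|G| * (#|T| + #|L|) <= 2 * #|T| ^ 3 * (#|T| + #|L|).
Proof.
case: (set_0Vmem G) => [G0|[e0 e0G]].
  exists (fun=> ord0), setT; split; first by move=> u v w; rewrite G0 inE.
  by rewrite cardsT G0 cards0; nia.
pose P p := [set p.1.1; p.1.2; p.2] \in G.
pose f (p : T * T * T) := s p.1.1 p.1.2 p.2.
have [p0 Pp0] : exists p0 : T * T * T, P p0.
  move: (sum_triples G3) e0G.
  case: (pickP (fun p : T * T * T => P p)) => [p hp|hP]; first by exists p.
  rewrite big1 => [|x _].
    by move=> h eG; have := cardsD1 e0 G; rewrite eG; lia.
  by rewrite big1 // => y _; rewrite big1 // => z _; have := hP (x, y, z); rewrite /P /= => ->.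
case: (@arg_maxnP _ p0 P f Pp0) => -[[x y] z]; rewrite /P /f /= => xyz smax.
pose U := nbr G x y :|: nbr G x z :|: nbr G y z.
(* The classes are the link neighbourhoods of an edge of largest weight. The third colour is also
   the default on [L], where colours do not matter. *)
exists (fun u => if u \in nbr G x y then ord0 else
          if u \in nbr G x z then lift ord0 ord0 else ord_max), (~: U); split.
  move=> u v w uvw; rewrite !(inE, negbK).
  have no a b : u \in nbr G a b -> v \in nbr G a b -> false.
    move=> h1 h2; have := nbr_indep h1 h2 => /eqP; rewrite cards_eq0 => /eqP/setP/(_ w).
    by rewrite !inE uvw.
  move: (no x y) (no x z) (no y z); rewrite !inE.
  by do 6!case: (_ \in G); move=> // h1 h2 h3;
    (have := h1 isT isT) || (have := h2 isT isT) || (have := h3 isT isT).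
have cL : #|~: U| + s x y z = #|T| by rewrite addnC -card_nbr3 // cardsC.
have nonadj := nonadjacent_pairs xyz.
have PZ : \sum_u \sum_v (0 < d u v) + \sum_u \sum_v (d u v == 0) = #|T| ^ 2.
  rewrite -big_split /= -mulnn -sum_nat_const; apply: eq_bigr => u _.
  rewrite -big_split /= -sum1_card; apply: eq_bigr => v _.
  by case: (d u v).
have se : 3 * \sum_u \sum_v d u v ^ 2 <= s x y z * \sum_u \sum_v d u v.
  rewrite -sum_edge_weights big_distrr; apply: leq_sum => u _ /=.
  rewrite big_distrr; apply: leq_sum => v _ /=.
  rewrite [X in _ * X]card_nbrE big_distrr; apply: leq_sum => w _ /=.
  case uvw: (_ \in G) => //; rewrite mul1n muln1.
  exact: (smax (u, v, w) uvw).
have sq : 6 * #|T| * \sum_u \sum_v d u v <=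
    9 * \sum_u \sum_v d u v ^ 2 + #|T| ^ 2 * \sum_u \sum_v (0 < d u v).
  rewrite !big_distrr -big_split; apply: leq_sum => u _ /=.
  rewrite !big_distrr -big_split; apply: leq_sum => v _ /=.
  move: #|T| (d u v) => n [|k]; first by rewrite !muln0.
  rewrite muln1; have := (nat_Cauchy (3 * k.+1) n).1; rewrite expnMn; lia.
have e6 : \sum_u \sum_v d u v = 6 * #|G|.
  rewrite -sum_triples //; apply: eq_bigr => u _; apply: eq_bigr => v _.
  exact: card_nbrE.
move: e6 sq se PZ nonadj cL.
move: (\sum_u \sum_v d u v) (\sum_u \sum_v (d u v)^2).
move: (\sum_u \sum_v (0 < d u v)) (\sum_u \sum_v (d u v == 0)).
move: (s x y z) #|~: U| #|G| #|T| => S l g n Pn Z e D e6 sq se PZ nonadj cL.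
have {}sq : 6 * n * e + n ^ 2 * Z <= 3 * (S * e) + n ^ 4.
  have -> : n ^ 4 = n ^ 2 * (Pn + Z) by rewrite PZ -expnD.
  rewrite mulnDr; lia.
have : n ^ 2 * S ^ 2 <= 3 * (n ^ 2 * Z) by rewrite mulnCA leq_mul2l nonadj orbT.
move: sq; move: (n ^ 2 * Z) => W.
(* With S = n - l and e = 6|G| the two bounds combine to 9e(n + l) <= 3n^4 - n^2(n - l)^2 = 2n^3(n +
   l) - n^2 l^2. *)
subst e; subst n => sq h.
nia.
Qed.

End Cancellative.

(** * Colourings and maximum cuts *)

Lemma ord3P (i : 'I_3) : [\/ i = ord0, i = lift ord0 ord0 | i = ord_max].
Proof.
by case: i => -[|[|[|i]]] // hi; [apply: Or31|apply: Or32|apply: Or33]; apply: val_inj.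
Qed.

Lemma lift_lift0 : lift ord0 (lift ord0 ord0) = ord_max :> 'I_3.
Proof. exact: val_inj. Qed.

Lemma crossing_ord3 (r p q u v : 'I_3) : r != p -> r != q -> p != q ->
  ([&& r != u, r != v & u != v] : nat) =
  ((u == p) && (v == q)) + ((u == q) && (v == p)).
Proof.
by case: (ord3P r) => ->; case: (ord3P p) => ->; case: (ord3P q) => -> // _ _ _;
  case: (ord3P u) => ->; case: (ord3P v) => ->.
Qed.

(** Partitions are handled as colourings: disjointness and covering are then automatic, and moving a
    vertex changes one value. *)
Definition parts (T : finType) (c : T -> 'I_3) (i : 'I_3) : {set T} :=
  [set x | c x == i].

Definition crossing (T : finType) (c : T -> 'I_3) (x y z : T) : bool :=
  [&& c x != c y, c x != c z & c y != c z].

Section Colourings.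
Variable T : finType.
Implicit Types (H : {set {set T}}) (V : 'I_3 -> {set T}) (c : T -> 'I_3) (x y z : T).

Lemma K_of_ext V W : V =1 W -> K_of V = K_of W.
Proof.
move=> VW; apply/setP => e; rewrite !inE; congr (_ && _).
by apply: eq_forallb => i; rewrite VW.
Qed.

Lemma parts_partition c : is_partition3 (parts c).
Proof.
split.
  move=> i j ij; rewrite -setI_eq0; apply/eqP/setP => x; rewrite !inE.
  by apply/negP => /andP [/eqP -> /eqP h]; rewrite h eqxx in ij.
by apply/setP => x; rewrite inE; apply/bigcupP; exists (c x); rewrite ?inE.
Qed.

Lemma partition_parts V : is_partition3 V -> exists c, V =1 parts c.
Proof.
move=> [Vd Vc].
have cov x : exists i, x \in V i.
  have /bigcupP [i _ xi] : x \in \bigcup_i V i by rewrite Vc inE.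
  by exists i.
exists (fun x => xchoose (cov x)) => i; apply/setP => x; rewrite inE.
have xV := xchooseP (cov x).
apply/idP/eqP => [xi | <- //]; apply/eqP; apply: contraT => ne.
by rewrite (disjointFr (Vd _ _ ne) xV) in xi.
Qed.

Lemma K_of_parts c x y z : ([set x; y; z] \in K_of (parts c)) = crossing c x y z.
Proof.
rewrite inE; apply/andP/idP => [[/eqP /cards3_neq [xy xz yz] /forallP h] | /and3P [xy xz yz]].
  have no u v : u \in [set x; y; z] -> v \in [set x; y; z] -> u != v -> c u != c v.
    move=> us vs uv; apply/negP => /eqP cuv.
    have : [set u; v] \subset [set x; y; z] :&: parts c (c v).
      by apply/subsetP => w; rewrite in_setI in_set2 => /orP [] /eqP ->; rewrite ?us ?vs inE ?cuv eqxx.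
    by move=> /subset_leq_card; rewrite cards2 uv (eqP (h _)).
  by apply/and3P; split; apply: no; rewrite ?inE ?eqxx ?orbT.
have ne u v : c u != c v -> u != v by apply: contraNN => /eqP ->.
split.
  by rewrite setUC cardsU1 cards2 !inE negb_or (eq_sym z x) (eq_sym z y) !ne.
apply/forallP => i.
have colour u v w : c u != c v -> c u != c w -> [set u; v; w] :&: parts c (c u) = [set u].
  move=> uv uw; apply/setP => t; rewrite !inE.
  case: (eqVneq t u) => [->|tu]; first by rewrite eqxx.
  case: (eqVneq t v) => [->|tv]; first by rewrite (eq_sym (c v)) (negbTE uv) andbF.
  by case: (eqVneq t w) => [->|//]; rewrite eq_sym (negbTE uw).
have : [|| i == c x, i == c y | i == c z].
  by move: xy xz yz; case: (ord3P (c x)) => ->; case: (ord3P (c y)) => ->;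
    case: (ord3P (c z)) => -> //; case: (ord3P i) => ->.
case/or3P => /eqP ->.
- by rewrite colour // cards1.
- by rewrite set3C12 colour ?cards1 // eq_sym.
- by rewrite set3C13 colour ?cards1 // eq_sym.
Qed.

Lemma K_of_3graph V : is_3graph (K_of V).
Proof. by apply/forall_inP => e; rewrite inE => /andP []. Qed.

Lemma sub_3graph (H F : {set {set T}}) : F \subset H -> is_3graph H -> is_3graph F.
Proof. by move=> /subsetP FH /forall_inP h; apply/forall_inP => e /FH /h. Qed.

Lemma sum_colours c (F : 'I_3 -> nat) : \sum_x F (c x) = \sum_i #|parts c i| * F i.
Proof.
rewrite (partition_big c xpredT) //=; apply: eq_bigr => i _.
rewrite -sum_nat_const; apply: eq_big => [x|x /eqP -> //].
by rewrite inE.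
Qed.

(** The crossing pairs at x are the ordered pairs between the other two parts; the factor for the
    part of x makes the right side independent of its colour. *)
Lemma sum_crossing_pairs c x :
  #|parts c (c x)| * \sum_y \sum_z crossing c x y z =
  2 * (#|parts c ord0| * #|parts c (lift ord0 ord0)| * #|parts c ord_max|).
Proof.
rewrite /crossing.
under eq_bigr => y _ do
  rewrite (sum_colours c (fun k => [&& c x != c y, c x != k & c y != k] : nat)).
rewrite (sum_colours c (fun j => \sum_k #|parts c k| * [&& c x != j, c x != k & j != k])).
rewrite !big_ord_recl !big_ord0 /=.
rewrite lift_lift0.
by case: (ord3P (c x)) => -> /=; rewrite ?(muln0, addn0, add0n, muln1); nia.
Qed.

Lemma card_K_of c : #|K_of (parts c)| =
  #|parts c ord0| * #|parts c (lift ord0 ord0)| * #|parts c ord_max|.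
Proof.
apply/eqP; rewrite -(eqn_pmul2l (isT : 0 < 6)) -sum_triples ?K_of_3graph //.
under eq_bigr => x _ do under eq_bigr => y _ do under eq_bigr => z _ do rewrite K_of_parts.
rewrite /crossing.
under eq_bigr => x _ do under eq_bigr => y _ do
  rewrite (sum_colours c (fun k => [&& c x != c y, c x != k & c y != k] : nat)).
under eq_bigr => x _ do
  rewrite (sum_colours c (fun j => \sum_k #|parts c k| * [&& c x != j, c x != k & j != k])).
rewrite (sum_colours c (fun i => \sum_j #|parts c j| *
  \sum_k #|parts c k| * [&& i != j, i != k & j != k])).
rewrite !big_ord_recl !big_ord0 /=.
rewrite lift_lift0.
by apply/eqP; rewrite ?(muln0, addn0, add0n, muln1); nia.
Qed.

Lemma card_K_of_split H c :
  #|K_of (parts c)| = #|H_of H (parts c)| + #|Hbar_of H (parts c)|.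
Proof.
rewrite -(cardsID (H_of H (parts c))); congr (_ + _); apply: eq_card => e.
by rewrite !in_setI; case: (e \in K_of _); rewrite ?andbF.
Qed.

Lemma sum_parts c : \sum_i #|parts c i| = #|T|.
Proof.
rewrite -sum1_card (partition_big c xpredT) //=; apply: eq_bigr => i _.
by rewrite -sum1_card; apply: eq_bigl => x; rewrite inE.
Qed.

Definition link_between H c x (p q : 'I_3) : nat :=
  \sum_a \sum_b [&& [set x; a; b] \in H, c a == p & c b == q].

Lemma link_betweenC H c x p q : link_between H c x p q = link_between H c x q p.
Proof.
rewrite /link_between exchange_big; apply: eq_bigr => a _; apply: eq_bigr => b _.
by rewrite set3C23 (andbC (c b == p)).
Qed.

Lemma link_of_crossing H c x p q : c x != p -> c x != q -> p != q ->
  \sum_a \sum_b ([set x; a; b] \in H_of H (parts c)) = 2 * link_between H c x p q.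
Proof.
move=> xp xq pq; rewrite mul2n -addnn {2}link_betweenC /link_between -big_split.
apply: eq_bigr => a _; rewrite -big_split; apply: eq_bigr => b _ /=.
rewrite in_setI K_of_parts; case: (_ \in H) => //=.
exact: crossing_ord3.
Qed.

(* Moving x to the part [p] does not increase the number of crossing edges. *)
Lemma max_cut_link H c x p q : is_3graph H ->
  (forall c', #|H_of H (parts c')| <= #|H_of H (parts c)|) ->
  c x != p -> c x != q -> p != q ->
  link_between H c x (c x) q <= link_between H c x p q.
Proof.
move=> H3 cmax xp xq pq.
pose c' u := if u == x then p else c u.
have c'x : c' x = p by rewrite /c' eqxx.
have HH c0 : is_3graph (H_of H (parts c0)) by apply: sub_3graph H3; apply: subsetIl.
have -> : link_between H c x (c x) q = link_between H c' x (c x) q.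
  apply: eq_bigr => a _; apply: eq_bigr => b _.
  case E: (_ \in H) => //=; have [xa xb _] := edge_neq H3 E.
  by rewrite /c' (eq_sym a) (eq_sym b) (negbTE xa) (negbTE xb).
rewrite -(leq_pmul2l (isT : 0 < 2)) -(@link_of_crossing H c) //.
rewrite -(@link_of_crossing H c') ?c'x //; last by rewrite eq_sym.
rewrite !sum_pairs // leq_pmul2l //.
have split c0 : #|H_of H (parts c0)| =
    #|[set e in H_of H (parts c0) | x \in e]| + #|[set e in H_of H (parts c0) | x \notin e]|.
  rewrite -(cardsID [set e : {set T} | x \in e]); congr (_ + _); apply: eq_card => e; rewrite !inE //.
  by rewrite andbC.
(* Edges avoiding x keep their status under the recolouring and cancel when the two cuts are
   compared. *)
have same : [set e in H_of H (parts c) | x \notin e] = [set e in H_of H (parts c') | x \notin e].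
  apply/setP => e; rewrite ![in RHS]inE ![in LHS]inE; case xe: (x \in e); rewrite ?andbF //= !andbT.
  congr (_ && (_ && _)); apply: eq_forallb => i; congr (_ == _); apply: eq_card => u.
  rewrite !inE /c'; case: (eqVneq u x) => [->|//]; first by rewrite xe.
have := cmax c'; rewrite (split c) (split c') same.
by rewrite leq_add2r.
Qed.

End Colourings.

Lemma subset_of_card (T : finType) (A : {set T}) k :
  k <= #|A| -> exists2 K : {set T}, K \subset A & #|K| = k.
Proof.
move=> kA; exists [set x in take k (enum A)].
  by apply/subsetP => x; rewrite inE => /mem_take; rewrite mem_enum.
rewrite cardsE (card_uniqP _) ?take_uniq ?enum_uniq // size_take -cardE.
by move: kA; rewrite leq_eqVlt => /orP [/eqP ->|->]; rewrite ?ltnn.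
Qed.

(** * Noncrossing edges *)

Section TripleSums.
Variable T : finType.
Implicit Type f : T -> T -> T -> nat.

Lemma sum3C12 f : \sum_x \sum_y \sum_z f y x z = \sum_x \sum_y \sum_z f x y z.
Proof. exact: exchange_big. Qed.

Lemma sum3C23 f : \sum_x \sum_y \sum_z f x z y = \sum_x \sum_y \sum_z f x y z.
Proof. by apply: eq_bigr => x _; apply: exchange_big. Qed.

Lemma sum3_rot f : \sum_x \sum_y \sum_z f y z x = \sum_x \sum_y \sum_z f x y z.
Proof. by rewrite (sum3C12 (fun x y z => f x z y)) sum3C23. Qed.

Lemma sum3_rot2 f : \sum_x \sum_y \sum_z f z x y = \sum_x \sum_y \sum_z f x y z.
Proof. by rewrite (sum3C23 (fun x y z => f y x z)) sum3C12. Qed.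

Lemma sum3C13 f : \sum_x \sum_y \sum_z f z y x = \sum_x \sum_y \sum_z f x y z.
Proof. by rewrite (sum3C12 (fun x y z => f z x y)) sum3_rot2. Qed.

Lemma sum_mem_left (K : {set T}) : \sum_a \sum_(b : T) ((a \in K) : nat) = #|K| * #|T|.
Proof.
rewrite exchange_big -[RHS]mulnC -sum_nat_const; apply: eq_big => // b _ /=.
by rewrite -sum1_card [RHS]big_mkcond; apply: eq_bigr => a _; case: (a \in K).
Qed.

End TripleSums.

(* p, q, r: the pairs xy, xz, yz are monochromatic; s1, s2, s3: they have
   codegree at most [t]; a, b, c: the vertices x, y, z lie in [A]. *)
Lemma monochromatic_cases (p q r s1 s2 s3 a b c : bool) :
  p ==> q ==> r -> p ==> r ==> q -> q ==> r ==> p ->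
  p ==> [|| s1, a | b] -> q ==> [|| s2, a | c] -> r ==> [|| s3, b | c] ->
  ~~ [&& ~~ p, ~~ q & ~~ r] <= (p && s1) + (q && s2) + (r && s3) +
    ([&& a, p & [|| b, c | ~~ q]] + [&& a, q & [|| c, b | ~~ p]] +
     [&& b, p & [|| a, c | ~~ r]] + [&& b, r & [|| c, a | ~~ p]] +
     [&& c, q & [|| a, b | ~~ r]] + [&& c, r & [|| b, a | ~~ q]]).
Proof. by case: p; case: q; case: r; case: s1; case: s2; case: s3; case: a; case: b; case: c. Qed.

Section Counting.
Variables (T : finType) (t : nat) (H : {set {set T}}) (c : T -> 'I_3).
Hypothesis H3 : is_3graph H.
Hypothesis Hfree : free_of (F5 t) H.

Local Notation n := #|T|.
Local Notation Hbar := (Hbar_of H (parts c)).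

Definition missing_degree x := \sum_a \sum_b ([set x; a; b] \in Hbar).

Lemma Hbar_3graph : is_3graph Hbar.
Proof. by apply: sub_3graph (K_of_3graph (parts c)); apply: subsetDl. Qed.

Lemma in_Hbar x y z : ([set x; y; z] \in Hbar) = crossing c x y z && ([set x; y; z] \notin H).
Proof. by rewrite in_setD in_setI K_of_parts; case: crossing; rewrite ?andbT ?andbF. Qed.

Lemma sum_missing_degree : \sum_x missing_degree x = 6 * #|Hbar|.
Proof. exact: sum_triples Hbar_3graph. Qed.

(* A pair ab of the link of x with few missing triples forces small codegrees
   of x with most vertices of the third part. *)
Lemma link_own_part (maxc : forall c', #|H_of H (parts c')| <= #|H_of H (parts c)|) x q m :
  c x != q ->
  link_between H c x (c x) q * m <= 6 * #|Hbar| \/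
  link_between H c x (c x) q <= m * n + t.+2 * n.
Proof.
move=> xq.
have [p [xp pq]] : exists p, c x != p /\ p != q.
  move: xq; case: (ord3P (c x)) => ->; case: (ord3P q) => -> // _;
  by [exists ord0 | exists (lift ord0 ord0) | exists ord_max].
pose miss a b := \sum_w ((c w == p) && ([set a; b; w] \notin H)).
case: (boolP [exists a, exists b,
    [&& [set x; a; b] \in H, c a == c x, c b == q & miss a b <= m]]).
  case/existsP => a /existsP [b /and4P [xab ax bq mab]]; right.
  (* For w in part p with abw in [H], the edges abx and abw bound the codegree of xw by t + 2; each
     of the at most m other w in part p contributes at most n. *)
  apply: leq_trans (max_cut_link H3 maxc xp xq pq) _.
  apply: (@leq_trans (miss a b * n + t.+2 * n)); last by rewrite leq_add2r leq_mul2r mab orbT.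
  rewrite /link_between /miss big_distrl [t.+2 * _]mulnC -sum_nat_const -big_split /=.
  apply: leq_sum => w _; case: (eqVneq (c w) p) => [wp|_] /=; last first.
    by rewrite big1 // => u _; rewrite andbF.
  case: (boolP ([set a; b; w] \in H)) => [abw|_] /=.
    rewrite mul0n add0n; apply: (@leq_trans #|nbr H x w|).
      rewrite -sum1_card [X in _ <= X]big_mkcond; apply: leq_sum => u _.
      by rewrite inE; case: (_ \in H) => //=; case: (_ == q).
    apply: (F5_free_nbr H3 Hfree (a := a) (b := b)) => //.
      by rewrite set3C23 set3C12.
    by apply: contraNneq xp => ->; rewrite wp.
  rewrite mul1n; apply: leq_trans (leq_addr _ _).
  rewrite -sum1_card; apply: leq_sum => u _; exact: leq_b1.
(* Otherwise each of these link pairs ab has more than m missing triples abw with w in part p, all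
   among the 6|Hbar| ordered missing triples. *)
move/existsPn => h; left.
rewrite -sum_triples ?Hbar_3graph // /link_between big_distrl.
apply: leq_sum => a _ /=; rewrite big_distrl; apply: leq_sum => b _ /=.
case: and3P => [[xab ax bq]|]; last by rewrite mul0n.
have /existsPn /(_ b) := h a; rewrite xab ax bq /= -ltnNge mul1n => /ltnW le.
apply: leq_trans le _; apply: leq_sum => w _; rewrite in_Hbar /crossing (eqP ax) (eqP bq).
by case: eqP => // ->; rewrite xq xp (eq_sym q) pq.
Qed.

(** Let [K] consist of t + 1 vertices of N(xy). If a crossing pair ab completes both x and y to
    edges, [F5_free_hit] places a or b in [K], which happens for at most 2(t + 1)n ordered pairs;
    every other crossing pair is missing at x or at y. *)
Lemma inner_pair_missing x y : x != y -> c x = c y -> t < #|nbr H x y| ->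
  \sum_a \sum_b crossing c x a b <= missing_degree x + missing_degree y + 2 * (t.+1 * n).
Proof.
move=> xy cxy /subset_of_card [K KN cK].
have sK := sum_mem_left K; rewrite cK in sK.
rewrite mul2n -addnn -{1}sK -sK [X in _ + _ + (_ + X)]exchange_big.
rewrite /missing_degree -!big_split; apply: leq_sum => a _; rewrite -!big_split.
apply: leq_sum => b _ /=; rewrite !in_Hbar.
have -> : crossing c y a b = crossing c x a b by rewrite /crossing cxy.
case: crossing => //=.
case xab: ([set x; a; b] \in H) => //=; case yab: ([set y; a; b] \in H) => //=.
have := @F5_free_hit T t H a b x y K H3 Hfree _ _ xy KN; rewrite cK ltnSn.
rewrite set3C23 set3C12 xab set3C23 set3C12 yab => /(_ isT isT isT).
by case/orP => ->; lia.
Qed.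

(** Two vertices outside this set together miss fewer than n^2/15 ordered pairs; the constant 30 is
    calibrated against the n^2/14 crossing pairs in [atypical_cover]. *)
Definition atypical : {set T} := [set x | n ^ 2 <= 30 * missing_degree x].

Lemma card_atypical : #|atypical| * n ^ 2 <= 180 * #|Hbar|.
Proof.
rewrite -[180]/(30 * 6) -mulnA -sum_missing_degree big_distrr /= -sum_nat_const big_mkcond.
by apply: leq_sum => x _; rewrite inE; case: ifP.
Qed.

(* Apart from edges with two vertices in [A], every noncrossing edge has a
   monochromatic pair of codegree at most [t] or consists of a vertex x of [A],
   a second vertex of its part and a vertex of another part. *)
Lemma card_noncrossing (A : {set T}) L :
  (forall x y, x != y -> c x = c y -> t < #|nbr H x y| -> (x \in A) || (y \in A)) ->
  (forall x q, x \in A -> c x != q -> link_between H c x (c x) q <= L) ->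
  2 * #|H :\: K_of (parts c)| <=
    t * \sum_i #|parts c i| ^ 2 + 4 * (#|A| ^ 2 * n) + 4 * (#|A| * L).
Proof.
move=> hA hL.
have B3 : is_3graph (H :\: K_of (parts c)) by apply: sub_3graph H3; apply: subsetDl.
(* [g] yields the main term t sum |V_i|^2, while [h] collects what is charged to [A]. *)
pose g x y z := [&& [set x; y; z] \in H, c x == c y & #|nbr H x y| <= t] : nat.
pose h x y z := [&& [set x; y; z] \in H, x \in A, c x == c y
                 & [|| y \in A, z \in A | c x != c z]] : nat.
have sg : \sum_x \sum_y \sum_z g x y z <= t * \sum_i #|parts c i| ^ 2.
  apply: (@leq_trans (\sum_x \sum_y (c x == c y) * t)).
    apply: leq_sum => x _; apply: leq_sum => y _; rewrite /g.
    case: (c x == c y) => /=; last by rewrite big1 // => z _; rewrite andbF.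
    rewrite mul1n; case: (leqP #|nbr H x y| t) => [le|_]; last first.
      by rewrite big1 // => z _; rewrite andbF.
    apply: leq_trans le; rewrite -sum1_card [X in _ <= X]big_mkcond.
    by apply: leq_sum => z _; rewrite inE; case: (_ \in H).
  under eq_bigr => x _ do rewrite -big_distrl /=.
  rewrite -big_distrl /= mulnC leq_mul2l; apply/orP; right.
  rewrite (sum_colours c (fun i => \sum_y (i == c y))).
  apply: leq_sum => i _; rewrite -mulnn leq_mul2l; apply/orP; right.
  rewrite -sum1_card [X in _ <= X]big_mkcond; apply: leq_sum => y _.
  by rewrite inE eq_sym; case: eqP.
have sh : \sum_x \sum_y \sum_z h x y z <= 2 * (#|A| ^ 2 * n) + 2 * (#|A| * L).
  have -> : 2 * (#|A| ^ 2 * n) + 2 * (#|A| * L) = \sum_(x in A) (2 * (#|A| * n) + 2 * L).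
    by rewrite sum_nat_const; lia.
  rewrite [X in _ <= X]big_mkcond; apply: leq_sum => x _; case: ifP => xA; last first.
    by rewrite /h big1 // => y _; rewrite big1 // => z _; rewrite xA andbF.
  have [p [q [xp xq pq]]] : exists p q, [/\ c x != p, c x != q & p != q].
    case: (ord3P (c x)) => ->.
    - by exists (lift ord0 ord0), ord_max.
    - by exists ord0, ord_max.
    - by exists ord0, (lift ord0 ord0).
  have sA := sum_mem_left A.
  have hp := hL _ _ xA xp; have hq := hL _ _ xA xq.
  (* For fixed x in [A], pairs with y or z in [A] number at most 2|A|n; otherwise z lies in one of
     the two other parts, and each of these two links is at most [L]. *)
  apply: (@leq_trans (#|A| * n + #|A| * n +
     (link_between H c x (c x) p + link_between H c x (c x) q))); last by lia.
  rewrite -{1}sA -sA [X in _ <= _ + X + _]exchange_big /link_between -!big_split.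
  apply: leq_sum => y _; rewrite -!big_split; apply: leq_sum => z _ /=; rewrite /h xA.
  case: (_ \in H) => //=; rewrite (eq_sym (c y)); case: (c x == c y) => //=.
  case: (y \in A) => //; case: (z \in A) => //=.
  by move: xp xq pq; case: (ord3P p) => ->; case: (ord3P q) => ->; case: (ord3P (c x)) => ->;
    case: (ord3P (c z)) => ->.
rewrite -(leq_pmul2l (isT : 0 < 3)) mulnA -[3 * 2]/6 -sum_triples //.
apply: (@leq_trans (\sum_x \sum_y \sum_z ((g x y z + g x z y + g y z x) +
    (h x y z + h x z y + h y x z + h y z x + h z x y + h z y x)))).
  apply: leq_sum => x _; apply: leq_sum => y _; apply: leq_sum => z _.
  rewrite in_setD K_of_parts /g /h.
  have -> : [set x; z; y] = [set x; y; z] by rewrite set3C23.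
  have -> : [set y; x; z] = [set x; y; z] by rewrite set3C12.
  have -> : [set y; z; x] = [set x; y; z] by rewrite set3C23 set3C12.
  have -> : [set z; x; y] = [set x; y; z] by rewrite set3C12 set3C23.
  have -> : [set z; y; x] = [set x; y; z] by rewrite set3C13.
  case E: (_ \in H); last by rewrite andbF.
  have [xy xz yz] := edge_neq H3 E.
  rewrite /crossing !(eq_sym (c y) (c x)) !(eq_sym (c z) (c x)) !(eq_sym (c z) (c y)) andbT.
  have pair u v : u != v -> (c u == c v) ==> [|| #|nbr H u v| <= t, u \in A | v \in A].
    move=> uv; apply/implyP => /eqP cuv; case: leqP => //=; exact: hA.
  (* An edge inside one part without a pair of small codegree has each of its three pairs met by
     [A], so two of its vertices lie in [A]. *)
  apply: monochromatic_cases; try exact: pair.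
  - by apply/implyP => /eqP ->; apply/implyP.
  - by apply/implyP => /eqP ->; apply/implyP.
  - by apply/implyP => /eqP ->; apply/implyP; rewrite eq_sym.
apply: (@leq_trans (3 * (\sum_x \sum_y \sum_z g x y z) +
    6 * (\sum_x \sum_y \sum_z h x y z))); last first.
  by move: sg sh; move: (\sum_x _) (\sum_x _) (\sum_i _) #|A| => G0 S0 V0 A0; lia.
under eq_bigr => x _ do under eq_bigr => y _ do rewrite !big_split /=.
under eq_bigr => x _ do rewrite !big_split /=.
rewrite !big_split /= !(sum3C23 g) !(sum3_rot g) !(sum3C23 h) !(sum3C12 h).
rewrite !(sum3_rot h) !(sum3_rot2 h) !(sum3C13 h).
by move: (\sum_x _) (\sum_x _) => G0 S0; lia.
Qed.

End Counting.

(** * The lower bound on [exF2] *)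

Section LowerBoundEx.
Variables m t : nat.
Hypothesis tm : t <= m.

(** Translation by a permutes the residues modulo m, and exactly t of them are below t since t <=
    m. *)
Lemma card_shift_modn a : #|[set k : 'I_m | (a + k) %% m < t]| = t.
Proof.
case: (posnP m) => [m0|m_gt0].
  have t0 : t = 0 by move: tm; rewrite m0; lia.
  by apply/eqP; rewrite t0 cards_eq0; apply/eqP/setP => k; rewrite !inE ltn0.
pose f (k : 'I_m) : 'I_m := Ordinal (ltn_pmod (a + k) m_gt0).
have f_inj : injective f.
  move=> k l /(congr1 val) /= /eqP; rewrite eqn_modDl !modn_small // => /eqP.
  exact: val_inj.
have -> : [set k : 'I_m | (a + k) %% m < t] = f @^-1: [set j : 'I_m | j < t].
  by apply/setP => k; rewrite !inE.
rewrite card_preimset // -sum1_card -[RHS]card_ord -sum1_card.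
rewrite [LHS](eq_bigl (fun i : 'I_m => i < t)); last by move=> i; rewrite inE.
by rewrite (big_ord_narrow tm).
Qed.

(* Two vertices and one of the [t] admissible residues determine the third
   vertex, so all codegrees are at most [t]. *)
Definition modular_triples : {set {set 'I_m}} :=
  [set e : {set 'I_m} | (#|e| == 3) && ((\sum_(i in e) i) %% m < t)].

Lemma modular_triples3 : is_3graph modular_triples.
Proof. by apply/forall_inP => e; rewrite inE => /andP []. Qed.

Lemma in_modular_triples (x y z : 'I_m) : x != y -> x != z -> y != z ->
  ([set x; y; z] \in modular_triples) = ((x + y + z) %% m < t).
Proof.
move=> xy xz yz; rewrite inE setUC cardsU1 cards2 !inE negb_or.
rewrite (eq_sym z x) (eq_sym z y) xy xz yz /=.
rewrite big_setU1 ?inE ?negb_or ?(eq_sym z) ?xz ?yz //=.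
by rewrite big_setU1 ?inE // big_set1 addnC.
Qed.

Lemma modular_triples_codegree (x y : 'I_m) : x != y -> codegree modular_triples x y <= t.
Proof.
move=> xy; rewrite -[X in _ <= X](card_shift_modn (x + y)).
apply: leq_trans (leq_imset_card (fun k => [set x; y; k]) _).
apply: subset_leq_card; apply/subsetP => e; rewrite inE => /and3P [eG xe ye].
have e3 := edge_card modular_triples3 eG.
have /card_gt0P [z] : 0 < #|e :\ x :\ y|.
  have := cardsD1 x e; rewrite xe e3 (cardsD1 y (e :\ x)) !inE (eq_sym y) xy ye.
  by case: #|_|.
move=> ze; have ee : [set x; y; z] = e.
  by apply/eqP; rewrite set3_eqE // xe ze !inE eq_sym xy ye.
apply/imsetP; exists z => //; rewrite inE.
by rewrite -in_modular_triples ?ee //; move: ze; rewrite !inE => /and3P []; rewrite !(eq_sym z).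
Qed.

(** Of the t m^2 ordered triples with admissible residue, at most 3mt have a repeated entry; the
    others are orderings of edges of [modular_triples], 6 for each. *)
Lemma exF2_lower : t * m ^ 2 <= 6 * exF2 m t + 3 * (m * t).
Proof.
apply: (@leq_trans (6 * #|modular_triples| + 3 * (m * t))); last first.
  rewrite leq_add2r leq_mul2l /= /exF2.
  apply: (bigmax_sup modular_triples) => //; rewrite modular_triples3 /=.
  apply/forallP => x; apply/forallP => y; apply/implyP; exact: modular_triples_codegree.
pose q (x y z : 'I_m) := (x + y + z) %% m < t.
have sq a : \sum_(z : 'I_m) ((a + z) %% m < t) = t.
  rewrite -[RHS](card_shift_modn a) -sum1_card [RHS]big_mkcond.
  by apply: eq_bigr => z _; rewrite inE; case: (_ < t).
have sumI k : \sum_(z : 'I_m) k = m * k by rewrite sum_nat_const card_ord.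
have sdiag : \sum_x \sum_y \sum_z ((x == y) && q x y z) = m * t.
  rewrite -sumI; apply: eq_bigr => x _; rewrite -[RHS](sq (x + x)) (bigD1 x) //=.
  rewrite [X in _ + X]big1 ?addn0; first by apply: eq_bigr => z _; rewrite eqxx.
  by move=> y; rewrite eq_sym => /negbTE ->; rewrite big1.
have sall : \sum_x \sum_y \sum_z q x y z = t * m ^ 2.
  rewrite [RHS]mulnC -mulnn -mulnA -!sumI; apply: eq_bigr => x _; apply: eq_bigr => y _.
  exact: sq.
rewrite -sall -sum_triples ?modular_triples3 //.
have -> : 3 * (m * t) = m * t + (m * t + m * t) by lia.
rewrite -{1}sdiag -{1}sdiag -{1}sdiag.
rewrite -{1}(sum3C23 (fun x y z => ((x == y) && q x y z) : nat)).
rewrite -[X in _ + (_ + (_ + X))](sum3_rot (fun x y z => ((x == y) && q x y z) : nat)).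
rewrite -!big_split; apply: leq_sum => x _; rewrite -!big_split; apply: leq_sum => y _.
rewrite -!big_split; apply: leq_sum => z _ /=.
have -> : q x z y = q x y z by rewrite /q addnAC.
have -> : q y z x = q x y z by rewrite /q addnC addnA.
case Q : (q x y z) => //; rewrite !andbT.
case: (eqVneq x y) => [_|xy]; first by rewrite addSn !addnS.
case: (eqVneq x z) => [_|xz]; first by rewrite addSn addnS.
case: (eqVneq y z) => [_|yz]; first by rewrite !addnS.
by rewrite in_modular_triples // -/(q x y z) Q.
Qed.

End LowerBoundEx.

(** Smoothing: while the largest and the smallest number differ by at least 2, moving a unit between
    them does not decrease the product and lowers the sum of squares, on which the induction runs.
    Otherwise the numbers are the three rounded thirds of their sum. *)
Lemma balanced_product a b c :
  a * b * c <= ((a + b + c) %/ 3) * ((a + b + c).+1 %/ 3) * ((a + b + c).+2 %/ 3).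
Proof.
have [k] := ubnP (a ^ 2 + b ^ 2 + c ^ 2); elim: k a b c => // k IH a b c.
move=> lek; suff P x y z : x <= y <= z -> x ^ 2 + y ^ 2 + z ^ 2 = a ^ 2 + b ^ 2 + c ^ 2 ->
    x + y + z = a + b + c -> x * y * z = a * b * c ->
    a * b * c <= ((a + b + c) %/ 3) * ((a + b + c).+1 %/ 3) * ((a + b + c).+2 %/ 3).
  case: (leqP a b) => [ab|/ltnW ba]; case: (leqP b c) => [bc|/ltnW cb].
  - by apply: (P a b c); rewrite ?ab.
  - case: (leqP a c) => [ac|/ltnW ca]; [apply: (P a c b)|apply: (P c a b)]; lia.
  - case: (leqP a c) => [ac|/ltnW ca]; [apply: (P b a c)|apply: (P b c a)]; lia.
  - by apply: (P c b a); lia.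
move=> + e2 e1 <-; rewrite -e1; rewrite -e2 in lek; clear a b c e1 e2.
move: x y z lek => a b c lek.
case/andP => ab bc; case: (leqP c a.+1) => ca.
  have [e|e] : b = a \/ b = a.+1 by lia.
  - have [f|f] : c = a \/ c = a.+1 by lia.
    + have -> : (a + b + c) %/ 3 = a by lia.
      have -> : (a + b + c).+1 %/ 3 = a by lia.
      have -> : (a + b + c).+2 %/ 3 = a by lia.
      by rewrite e f.
    + have -> : (a + b + c) %/ 3 = a by lia.
      have -> : (a + b + c).+1 %/ 3 = a by lia.
      have -> : (a + b + c).+2 %/ 3 = a.+1 by lia.
      by rewrite e f.
  - have f : c = a.+1 by lia.
    have -> : (a + b + c) %/ 3 = a by lia.
    have -> : (a + b + c).+1 %/ 3 = a.+1 by lia.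
    have -> : (a + b + c).+2 %/ 3 = a.+1 by lia.
    by rewrite e f.
have [i ci] : exists i, c = a + i.+2 by exists (c - a.+2); lia.
have e : a.+1 + b + (a + i.+1) = a + b + c by lia.
have := IH a.+1 b (a + i.+1); rewrite e => h; apply: leq_trans (h _).
  rewrite mulnAC [X in _ <= X]mulnAC leq_mul2r; apply/orP; right.
  by rewrite ci; clear; nia.
rewrite -ltnS; apply: leq_trans lek.
by rewrite ltnS addnAC (addnAC (a ^ 2)) ltn_add2r ci; clear; nia.
Qed.

(** * Crossing edges of a maximum cut *)

Section SmallHbar.
Variables (T : finType) (t : nat) (H : {set {set T}}) (c : T -> 'I_3).
Hypothesis H3 : is_3graph H.
Hypothesis Hfree : free_of (F5 t) H.
Hypothesis maxc : forall c', #|H_of H (parts c')| <= #|H_of H (parts c)|.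
Local Notation n := #|T|.

(** The cut found by stability for the cancellative subgraph [G] misses only edges of [G] that meet
    [L], at most l n^2 of them, and a maximum cut of [H] does at least as well. *)
Lemma few_noncrossing : n ^ 3 <= 27 * #|H| + 6 * n ^ 2 ->
  exists2 l, l ^ 2 <= (108 * t + 348) * n &
    #|H| <= #|H_of H (parts c)| + (l + t.+3) * n ^ 2.
Proof.
move=> big; have [G [GH G3 Gc HG]] := F5_free_cancellative H3 Hfree.
have [c0 [L [hL lL]]] := cancellative_stability G3 Gc.
have Ln : #|L| <= n by apply: max_card.
exists #|L|.
  (* The constant 108t + 348 is 4(6 + 27(t + 3)): n + l <= 2n, and n^3 - 27|G| <= (6 + 27(t +
     3))n^2. *)
  have : #|L| ^ 2 * n ^ 2 <= 2 * (n + #|L|) * (n ^ 3 - 27 * #|G|).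
    move: lL; move: #|L| #|G| n => l g k; move: (k ^ 3) (l ^ 2 * k ^ 2) => A B; nia.
  case: (posnP n) => [n0|n0]; first by move: Ln; rewrite n0; lia.
  move=> h; rewrite -(@leq_pmul2r (n ^ 2)) ?expn_gt0 ?n0 //; apply: leq_trans h _.
  have : n ^ 3 - 27 * #|G| <= (6 + 27 * t.+3) * n ^ 2 by move: big HG; lia.
  move: Ln; move: (n ^ 3 - 27 * #|G|) => d; move: #|L| n => l k h1 h2.
  apply: (@leq_trans (4 * k * d)).
    by rewrite leq_mul2r; apply/orP; right; move: h1; clear; lia.
  apply: leq_trans (leq_mul (leqnn (4 * k)) h2) _; rewrite mulnA leq_mul2r.
  by apply/orP; right; move: t; clear; lia.
have HG3 : is_3graph (H_of H (parts c0)) by apply: sub_3graph H3; apply: subsetIl.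
suff : #|G| <= #|H_of H (parts c0)| + #|L| * n ^ 2 by move: (maxc c0) HG; lia.
rewrite -(leq_pmul2l (isT : 0 < 6)) -sum_triples //.
apply: (@leq_trans (\sum_x \sum_y \sum_z (([set x; y; z] \in H_of H (parts c0)) +
   ((x \in L) + (y \in L) + (z \in L))))).
  apply: leq_sum => x _; apply: leq_sum => y _; apply: leq_sum => z _.
  case E: (_ \in G) => //; rewrite in_setI K_of_parts (subsetP GH _ E) /=.
  case: (boolP (x \in L)) => [_|xL]; first by rewrite ?(addSn, addnS).
  case: (boolP (y \in L)) => [_|yL]; first by rewrite ?(addSn, addnS).
  case: (boolP (z \in L)) => [_|zL]; first by rewrite ?(addSn, addnS).
  rewrite /crossing (hL _ _ _ E xL yL) (hL x z y) 1?set3C23 ?E //.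
  by rewrite (hL y z x) // set3C23 set3C12 E.
under eq_bigr => x _ do under eq_bigr => y _ do rewrite big_split /=.
under eq_bigr => x _ do rewrite big_split /=.
rewrite big_split /= sum_triples // mulnDr leq_add2l.
pose f (x y z : T) := (x \in L) : nat.
have sf : \sum_x \sum_y \sum_z f x y z = #|L| * n ^ 2.
  have sc k : \sum_(z : T) k = k * n by rewrite sum_nat_const mulnC; congr (_ * _); apply: eq_card.
  rewrite -mulnn mulnA -sum_mem_left big_distrl; apply: eq_bigr => x _ /=.
  by rewrite big_distrl; apply: eq_bigr => y _; rewrite sc.
apply: (@leq_trans (3 * (#|L| * n ^ 2))); last by rewrite leq_mul2r orbT.
have -> : 3 * (#|L| * n ^ 2) = \sum_x \sum_y \sum_z f x y z +
   \sum_x \sum_y \sum_z f y x z + \sum_x \sum_y \sum_z f z x y.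
  by rewrite (sum3C12 f) (sum3_rot2 f) sf !mulSn mul0n addn0 addnA.
rewrite -!big_split; apply: leq_sum => x _; rewrite -!big_split; apply: leq_sum => y _.
by rewrite -!big_split; apply: leq_sum => z _.
Qed.

End SmallHbar.

(** * Atypical vertices of a maximum cut *)

Section Core.
Variables (T : finType) (t : nat) (H : {set {set T}}) (c : T -> 'I_3).
Hypothesis H3 : is_3graph H.
Hypothesis Hfree : free_of (F5 t) H.
Hypothesis maxc : forall c', #|H_of H (parts c')| <= #|H_of H (parts c)|.
Local Notation n := #|T|.
Local Notation K := (K_of (parts c)).
Local Notation Hbar := (Hbar_of H (parts c)).

(** At least n^2/14 ordered pairs cross at x, since its part has at most n vertices. Were x and y
    both typical, [inner_pair_missing] would give n^2/14 < n^2/15 + 2(t + 1)n, that is n < 420(t +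
    1). *)
Lemma atypical_cover x y : n ^ 3 <= 28 * #|K| -> 420 * t.+1 < n ->
  x != y -> c x = c y -> t < #|nbr H x y| ->
  (x \in atypical H c) || (y \in atypical H c).
Proof.
move=> bigK bign xy cxy tn; apply: contraT; rewrite negb_or !inE -!ltnNge => /andP [hx hy].
exfalso.
have := inner_pair_missing H3 Hfree xy cxy tn; have := sum_crossing_pairs c x.
rewrite -card_K_of; have : #|parts c (c x)| <= n by apply: max_card.
move: hx hy bigK bign; clear.
move: (missing_degree H c x) (missing_degree H c y) (\sum_a \sum_b crossing c x a b).
move: #|K| #|parts c (c x)| n => k v N p q w hx hy bigK bign vN vw w_le.
have h1 : N * w >= 2 * k by rewrite -vw leq_mul2r vN orbT.
have h2 : N * N ^ 2 <= N * (14 * w).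
  rewrite -expnS mulnCA; apply: leq_trans bigK _.
  by rewrite -[28]/(14 * 2) -mulnA leq_mul2l h1 orbT.
have N0 : 0 < N by lia.
rewrite leq_pmul2l // in h2.
have : 420 * t.+1 * N < N * N by rewrite ltn_mul2r N0.
move: h2 hx hy w_le; rewrite -mulnn; move: (N * N) => M; rewrite -mulnA; move: (t.+1 * N) => W.
lia.
Qed.

(** [L] is the maximum of the two alternatives of [link_own_part]; [m] stays free and later becomes
    a small fraction of n. *)
Lemma noncrossing_core m : n ^ 3 <= 28 * #|K| -> 420 * t.+1 < n -> 0 < m ->
  exists a L, [/\ a * n ^ 2 <= 180 * #|Hbar|,
    L * m <= 6 * #|Hbar| \/ L <= m * n + t.+2 * n
    & 2 * #|H :\: K| <= t * \sum_i #|parts c i| ^ 2 + 4 * (a ^ 2 * n) + 4 * (a * L)].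
Proof.
move=> bigK bign m0.
exists #|atypical H c|, (maxn (6 * #|Hbar| %/ m) (m * n + t.+2 * n)); split.
- exact: card_atypical.
- rewrite /maxn; case: ltnP => _; [by right | left; exact: leq_trunc_div].
- apply: card_noncrossing => // [x y|x q _ xq]; first exact: atypical_cover.
  by rewrite leq_max leq_divRL //; case: (link_own_part H3 Hfree maxc m xq) => ->; rewrite ?orbT.
Qed.

End Core.

(** * Consequences of the lower bound on |H| *)

Lemma card_noncrossing_lower (T : finType) (t : nat) (H : {set {set T}})
    (c : T -> 'I_3) : s_circ t #|T| <= #|H| ->
  #|Hbar_of H (parts c)| +
    (exF2 (#|T| %/ 3) t + exF2 (#|T|.+1 %/ 3) t + exF2 (#|T|.+2 %/ 3) t)
  <= #|H :\: K_of (parts c)|.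
Proof.
rewrite /s_circ -(cardsID (K_of (parts c)) H).
have := card_K_of_split H c.
have := balanced_product #|parts c ord0| #|parts c (lift ord0 ord0)| #|parts c ord_max|.
rewrite -card_K_of; have := sum_parts c; rewrite !big_ord_recl big_ord0 addn0.
rewrite lift_lift0.
rewrite addnA => ->.
rewrite /H_of; move: #|H :&: K_of (parts c)| #|H :\: K_of (parts c)|.
move: #|K_of (parts c)| #|Hbar_of H (parts c)| (exF2 _ _) (exF2 _ _) (exF2 _ _).
move=> k y e1 e2 e3 h b; move: (#|T| %/ 3 * (#|T|.+1 %/ 3) * (#|T|.+2 %/ 3)) => P; lia.
Qed.

Lemma balanced_product_lower n :
  n ^ 3 <= 27 * ((n %/ 3) * (n.+1 %/ 3) * (n.+2 %/ 3)) + 6 * n ^ 2.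
Proof.
have := divn_eq n 3; have := ltn_pmod n (isT : 0 < 3).
move: (n %/ 3) (n %% 3) => q r r3 e.
have [e0 | [e0 | e0]] : r = 0 \/ r = 1 \/ r = 2 by lia.
- have -> : n.+1 %/ 3 = q by lia.
  have -> : n.+2 %/ 3 = q by lia.
  rewrite e e0; nia.
- have -> : n.+1 %/ 3 = q by lia.
  have -> : n.+2 %/ 3 = q.+1 by lia.
  rewrite e e0; nia.
- have -> : n.+1 %/ 3 = q.+1 by lia.
  have -> : n.+2 %/ 3 = q.+1 by lia.
  rewrite e e0; nia.
Qed.

(** The three bounds [exF2_lower] add up, and the squares of the rounded thirds sum to at least
    n^2/3. *)
Lemma sum_exF2_lower t n : t <= n %/ 3 ->
  t * n ^ 2 <= 18 * (exF2 (n %/ 3) t + exF2 (n.+1 %/ 3) t + exF2 (n.+2 %/ 3) t) + 9 * (t * n).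
Proof.
move=> tn.
have h1 := exF2_lower tn.
have h2 := @exF2_lower (n.+1 %/ 3) t ltac:(lia).
have h3 := @exF2_lower (n.+2 %/ 3) t ltac:(lia).
move: h1 h2 h3.
have : n %/ 3 + n.+1 %/ 3 + n.+2 %/ 3 = n by lia.
move: (exF2 _ _) (exF2 _ _) (exF2 _ _) => e1 e2 e3.
move: (n %/ 3) (n.+1 %/ 3) (n.+2 %/ 3) => p q r <-.
have := (nat_Cauchy p q).1; have := (nat_Cauchy p r).1; have := (nat_Cauchy q r).1.
clear => h1 h2 h3 h4 h5 h6.
have : t * (p + q + r) ^ 2 <= t * (3 * (p ^ 2 + q ^ 2 + r ^ 2)).
  by rewrite leq_mul2l; apply/orP; right; rewrite !sqrnD !(mulnDl, mulnDr); lia.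
rewrite mulnCA !mulnDr; lia.
Qed.

Import Order.TTheory GRing.Theory Num.Theory.
Local Open Scope ring_scope.

(** * Real estimates *)

(** With q = ab + bc + ca, the inequality q^2 >= 3abcn forces q close to n^2/3, and the sum of
    squares is n^2 - 2q. The condition eta <= 1/27 gives (1/3 - 9 eta)^2 <= 1/9 - 3 eta. *)
Lemma sum_sqr_le_of_product (R : realFieldType) (a b c n eta : R) :
  0 <= a -> 0 <= b -> 0 <= c -> a + b + c = n -> 0 < n -> 0 <= eta -> eta <= 1 / 27 ->
  n ^+ 3 * (1 - 27 * eta) <= 27 * (a * b * c) ->
  a ^+ 2 + b ^+ 2 + c ^+ 2 <= (1 / 3 + 18 * eta) * n ^+ 2.
Proof.
move=> a0 b0 c0 e n0 eta0 eta1 h.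
pose q := a * b + b * c + c * a.
have q0 : 0 <= q by rewrite /q; nra.
have qq : 3 * (a * b * c) * n <= q ^+ 2.
  have := sqr_ge0 (a * b - b * c); have := sqr_ge0 (b * c - c * a); have := sqr_ge0 (c * a - a * b).
  by rewrite -e /q; nra.
have q2 : (1 / 9 - 3 * eta) * n ^+ 4 <= q ^+ 2.
  apply: le_trans qq.
  have -> : (1 / 9 - 3 * eta) * n ^+ 4 = 1 / 9 * (n ^+ 3 * (1 - 27 * eta)) * n by field.
  by rewrite ler_pM2r //; lra.
have : (1 / 3 - 9 * eta) * n ^+ 2 <= q.
  rewrite leNgt; apply/negP => lt.
  have : q ^+ 2 < ((1 / 3 - 9 * eta) * n ^+ 2) ^+ 2 by rewrite ltrXn2r // ?nnegrE //; lra.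
  have : ((1 / 3 - 9 * eta) * n ^+ 2) ^+ 2 <= (1 / 9 - 3 * eta) * n ^+ 4.
    rewrite exprMn -exprM ler_wpM2r ?exprn_ge0 ?ltW //; nra.
  lra.
have -> : a ^+ 2 + b ^+ 2 + c ^+ 2 = n ^+ 2 - 2 * q by rewrite -e /q; ring.
lra.
Qed.

(* Used with y = |Hbar|, B the number of noncrossing edges, S the sum of the
   |V_i|^2, a the number of atypical vertices, L a bound on their links between
   their own part and another one, ex the sum of the three exF2. *)
Lemma missing_bound (R : realFieldType) (n t y a L B S ex eta gam eps : R) :
  0 < n -> 0 <= t -> 0 <= y -> 0 <= a -> 0 <= L -> 0 < eta -> 0 < gam -> eps <= 1 ->
  y <= eta * n ^+ 3 -> S <= (1 / 3 + 18 * eta) * n ^+ 2 ->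
  a * n ^+ 2 <= 180 * y -> L <= gam * n ^+ 2 ->
  2 * B <= t * S + 4 * (a ^+ 2 * n) + 4 * (a * L) ->
  y + ex <= B -> t * n ^+ 2 <= 18 * ex + 9 * (t * n) -> 1 <= 2 * eta * n ->
  10 * eta + 720 * (180 * eta + gam) <= eps ->
  y <= (1 / 9 + eps) * t * n ^+ 2.
Proof.
move=> n0 t0 y0 a0 L0 eta0 gam0 eps1 hy hS ha hL hB hyB hex hn heps.
have n20 : 0 < n ^+ 2 by apply: exprn_gt0.
have a_le : a <= 180 * eta * n.
  rewrite -(ler_pM2r n20); apply: le_trans ha _.
  have -> : 180 * eta * n * n ^+ 2 = 180 * (eta * n ^+ 3) by ring.
  by rewrite ler_pM2l.
have a2 : a ^+ 2 * n <= 180 * eta * (180 * y).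
  apply: (@le_trans _ _ (180 * eta * (a * n ^+ 2))); last by rewrite ler_pM2l //; lra.
  have -> : 180 * eta * (a * n ^+ 2) = (a * n) * (180 * eta * n) by ring.
  have -> : a ^+ 2 * n = (a * n) * a by ring.
  by rewrite ler_wpM2l // mulr_ge0 // ltW.
have aL : a * L <= gam * (180 * y).
  apply: (@le_trans _ _ (gam * (a * n ^+ 2))); last by rewrite ler_pM2l.
  by rewrite mulrCA ler_wpM2l.
have tS : t * S <= t * ((1 / 3 + 18 * eta) * n ^+ 2) by rewrite ler_wpM2l.
have tn : t * n <= t * (2 * eta * n ^+ 2).
  rewrite ler_wpM2l //; have -> : 2 * eta * n ^+ 2 = (2 * eta * n) * n by ring.
  by apply: ler_peMl => //; exact: ltW.
(* Half of the two error terms 4a^2 n and 4aL is at most [kap] times y, which moves to the left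
   side. *)
pose kap := 360 * (180 * eta + gam).
have k1 : 0 < 1 - kap by rewrite /kap; lra.
have tn2 : 0 <= t * n ^+ 2 by rewrite mulr_ge0 // ltW.
(* The main term is 1/6 - 1/18 = 1/9; of the 10 eta, 9 come from the bound on S and 1 from the
   linear term 9tn. *)
have h1 : (1 - kap) * y <= (1 / 9 + 10 * eta) * (t * n ^+ 2).
  rewrite /kap; nra.
have h2 : (1 / 9 + 10 * eta) <= (1 - kap) * (1 / 9 + eps) by rewrite /kap; nra.
rewrite -(ler_pM2l k1).
have -> : (1 - kap) * ((1 / 9 + eps) * t * n ^+ 2) =
  (1 - kap) * (1 / 9 + eps) * (t * n ^+ 2) by ring.
by apply: le_trans h1 _; apply: ler_wpM2r.
Qed.

Lemma leq_natr (R : realType) (m n : nat) : (m <= n)%N -> m%:R <= n%:R :> R.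
Proof. by rewrite ler_nat. Qed.

Lemma eventually_ge (R : realType) (x : R) :
  exists N : nat, forall n : nat, (N <= n)%N -> x <= n%:R.
Proof.
exists (Num.bound `|x|) => n /(leq_natr R); apply: le_trans.
by apply: le_trans (ler_norm x) (ltW (archi_boundP (normr_ge0 x))).
Qed.

Lemma cube_AGM (R : realFieldType) (a b c : R) :
  0 <= a -> 0 <= b -> 0 <= c -> 27 * (a * b * c) <= (a + b + c) ^+ 3.
Proof.
move=> a0 b0 c0.
have h1 := mulr_ge0 (addr_ge0 (addr_ge0 a0 b0) c0) (sqr_ge0 (a - b)).
have h2 := mulr_ge0 (addr_ge0 (addr_ge0 a0 b0) c0) (sqr_ge0 (b - c)).
have h3 := mulr_ge0 (addr_ge0 (addr_ge0 a0 b0) c0) (sqr_ge0 (c - a)).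
have h4 := mulr_ge0 a0 (sqr_ge0 (b - c)).
have h5 := mulr_ge0 b0 (sqr_ge0 (c - a)).
have h6 := mulr_ge0 c0 (sqr_ge0 (a - b)).
lra.
Qed.

Theorem theorem3p2 (R : realType) (t : nat) (eps : R) (heps : 0 < eps) :
  exists N : nat, (0 < N)%N /\
    forall n : nat, (N < n)%N ->
    forall H : {set {set 'I_n}},
      is_3graph H -> free_of (F5 t) H -> (s_circ t n <= #|H|)%N ->
    forall V : 'I_3 -> {set 'I_n},
      maximizing_partition H V ->
      #|Hbar_of H V|%:R <= (1 / 9 + eps) * t%:R * n%:R ^+ 2 :> R.
Proof.
(* [missing_bound] needs its epsilon at most 1; [gam] then takes a quarter of the budget there, as
   720 gam = e1/4. *)
pose e1 := Num.min eps 1.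
have e1_gt0 : 0 < e1 by rewrite lt_min heps ltr01.
have e1_le1 : e1 <= 1 by rewrite ge_min lexx orbT.
have e1_le : e1 <= eps by rewrite ge_min lexx.
pose gam := e1 / 2880.
have gam0 : 0 < gam by rewrite /gam; lra.
(* With m the integer part of n/q, the alternative L <= mn + (t + 2)n gives Lq <= 2n^2, hence L <=
   gam n^2. *)
have [q hq] : exists q : nat, 2 / gam < q%:R.
  by exists (Num.bound (2 / gam)); apply: archi_boundP; rewrite divr_ge0 // ltW.
have q0 : 0 < q%:R :> R by apply: le_lt_trans hq; rewrite divr_ge0 // ltW.
(* The three bounds serve in turn the budget 10 eta + 720 * 180 eta <= 3 e1/4, the estimate n^3 <=
   28|K|, and the alternative Lm <= 6|Hbar|, which gives L <= 12 q eta n^2. *)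
pose eta := Num.min (Num.min (e1 / 1000 / 1000) (1 / 2000)) (gam / (12 * q%:R)).
have eta_gt0 : 0 < eta.
  rewrite !lt_min; apply/andP; split; last by rewrite divr_gt0 // mulr_gt0.
  by apply/andP; split; move: e1_gt0; clear; lra.
have eta1 : eta <= e1 / 1000 / 1000 by rewrite !ge_min lexx.
have eta2 : eta <= 1 / 2000 by rewrite !ge_min lexx orbT.
have eta3 : 12 * q%:R * eta <= gam.
  rewrite mulrC -ler_pdivlMr ?mulr_gt0 //; by rewrite !ge_min lexx orbT.
pose C := (108 * t + 348)%N.
(* [N1] ensures l <= eta n/2, [N2] ensures t + 4 <= eta n/2, and [N3] ensures 1 <= eta n. *)
have [N1 hN1] := eventually_ge (4 * C%:R / eta ^+ 2).
have [N2 hN2] := eventually_ge (2 * t.+4%:R / eta).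
have [N3 hN3] := eventually_ge (1 / eta).
exists (N1 + N2 + N3 + 420 * t.+1 + t.+2 * q + 2 * q).+1; split; first exact: ltn0Sn.
move=> n hn H H3 Hfree Hbig V [Vpart Vmax].
have [c Vc] := partition_parts Vpart.
have HK W : W =1 parts c -> H_of H W = H_of H (parts c) by move=> e; rewrite /H_of (K_of_ext e).
have -> : Hbar_of H V = Hbar_of H (parts c) by rewrite /Hbar_of (HK _ Vc) (K_of_ext Vc).
have maxc c' : (#|H_of H (parts c')| <= #|H_of H (parts c)|)%N.
  by rewrite -(HK _ Vc); apply: Vmax; apply: parts_partition.
have cn : #|'I_n| = n by rewrite card_ord.
have X0 : 0 < n%:R :> R by rewrite ltr0n; exact: leq_ltn_trans hn.
set X := n%:R in X0 *.
have X1 : 4 * C%:R / eta ^+ 2 <= X by apply: hN1; move: hn; clear; lia.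
have X2 : 2 * t.+4%:R / eta <= X by apply: hN2; move: hn; clear; lia.
have X3 : 1 / eta <= X by apply: hN3; move: hn; clear; lia.
rewrite ler_pdivrMr ?exprn_gt0 // in X1.
rewrite ler_pdivrMr // in X2; rewrite ler_pdivrMr // in X3.
have Hbig3 : (n ^ 3 <= 27 * #|H| + 6 * n ^ 2)%N.
  apply: leq_trans (balanced_product_lower n) _; rewrite leq_add2r leq_mul2l /=.
  by apply: leq_trans Hbig; rewrite /s_circ -!addnA leq_addr.
have := few_noncrossing H3 Hfree maxc; rewrite cn => /(_ Hbig3) [l l2 Hl].
have lX : l%:R + t.+4%:R <= eta * X.
  have : l%:R ^+ 2 <= C%:R * X by move: (leq_natr R l2); rewrite natrM natrX.
  move=> h; have : l%:R <= eta * X / 2.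
    rewrite -(ler_pXn2r (isT : (0 < 2)%N)) ?nnegrE ?divr_ge0 ?mulr_ge0 ?(ltW X0) ?(ltW eta_gt0) //.
    apply: le_trans h _; have -> : (eta * X / 2) ^+ 2 = (X * eta ^+ 2) / 4 * X by field.
    by rewrite ler_wpM2r ?(ltW X0) //; move: X1; clear; lra.
  by move: X2; clear; lra.
have KE : #|K_of (parts c)|%:R = #|H_of H (parts c)|%:R + #|Hbar_of H (parts c)|%:R :> R.
  by rewrite -natrD -card_K_of_split.
pose v i := #|parts c i|%:R : R.
have vsum : v ord0 + v (lift ord0 ord0) + v ord_max = X.
  rewrite /X -[in RHS]cn -(sum_parts c) !big_ord_recl big_ord0 addn0 !natrD addrA.
  by rewrite lift_lift0.
have Kv : #|K_of (parts c)|%:R = v ord0 * v (lift ord0 ord0) * v ord_max.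
  by rewrite card_K_of !natrM.
have HbigR : X ^+ 3 <= 27 * #|H|%:R + 6 * X ^+ 2.
  by move: (leq_natr R Hbig3); rewrite natrX natrD (natrM _ 27) (natrM _ 6) natrX.
have HlR : #|H|%:R <= #|H_of H (parts c)|%:R + (l%:R + t.+3%:R) * X ^+ 2.
  by move: (leq_natr R Hl); rewrite natrD natrM natrX natrD.
(* The extra 1 absorbs the error 6n^2 in n^3 <= 27|H| + 6n^2. *)
have t34 : t.+4%:R = t.+3%:R + 1 :> R by rewrite -natr1.
have etaX : (l%:R + t.+3%:R + 1) * X ^+ 2 <= eta * X ^+ 3.
  have -> : eta * X ^+ 3 = eta * X * X ^+ 2 by ring.
  by rewrite ler_wpM2r ?exprn_ge0 ?(ltW X0) //; move: lX; rewrite t34 addrA.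
have vge0 i : 0 <= v i by apply: ler0n.
have Kle : 27 * #|K_of (parts c)|%:R <= X ^+ 3.
  by rewrite Kv -vsum; apply: cube_AGM.
have Kge : X ^+ 3 * (1 - 27 * eta) <= 27 * #|K_of (parts c)|%:R.
  have := ler0n R #|Hbar_of H (parts c)|; move: etaX HlR HbigR; rewrite KE.
  have : 0 <= X ^+ 2 by rewrite exprn_ge0 // ltW.
  by clear; lra.
have y_le : #|Hbar_of H (parts c)|%:R <= eta * X ^+ 3.
  move: etaX HlR HbigR Kle; rewrite KE.
  have : 0 <= X ^+ 2 by rewrite exprn_ge0 // ltW.
  by clear; lra.
have S_le : \sum_i v i ^+ 2 <= (1 / 3 + 18 * eta) * X ^+ 2.
  rewrite !big_ord_recl big_ord0 addr0 addrA.
  rewrite lift_lift0.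
  by apply: sum_sqr_le_of_product => //; rewrite -?Kv ?(ltW eta_gt0) //; move: eta2; clear; lra.
have K28 : (n ^ 3 <= 28 * #|K_of (parts c)|)%N.
  rewrite -(ler_nat R) natrM natrX -/X.
  have X30 : 0 <= X ^+ 3 by rewrite exprn_ge0 // ltW.
  have : X ^+ 3 * eta <= X ^+ 3 * (1 / 2000) by rewrite ler_wpM2l.
  by move: Kge X30; clear; lra.
have qn : (0 < q)%N by rewrite -(ltr0n R).
have m0 : (0 < n %/ q)%N by rewrite divn_gt0 //; move: hn; clear; lia.
have := @noncrossing_core _ t H c H3 Hfree maxc (n %/ q); rewrite cn.
case/(_ K28 _ m0); first by move: hn; clear; lia.
move=> a [L [ha hL hB]].
have := @card_noncrossing_lower _ t H c; rewrite cn => /(_ Hbig) hy.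
have hex := @sum_exF2_lower t n ltac:(move: hn; clear; lia).
set ex := (exF2 (n %/ 3) t + exF2 (n.+1 %/ 3) t + exF2 (n.+2 %/ 3) t)%N in hy hex.
apply: (@le_trans _ _ ((1 / 9 + e1) * t%:R * X ^+ 2)); last first.
  by rewrite -!mulrA ler_wpM2r ?lerD2l // mulr_ge0 // exprn_ge0 // ltW.
apply: (@missing_bound _ X t%:R _ a%:R L%:R #|H :\: K_of (parts c)|%:R
  (\sum_i v i ^+ 2) ex%:R eta gam) => //.
- by move: (leq_natr R ha); rewrite !natrM.
- have mq : X <= 2 * q%:R * (n %/ q)%:R.
    rewrite -!natrM; apply: leq_natr.
    have := divn_eq n q; have := ltn_pmod n qn; move: m0; clear; nia.
  case: hL => hL.
    have h1 : L%:R * (n %/ q)%:R <= 6 * (eta * X ^+ 3).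
      apply: (@le_trans _ _ (6 * #|Hbar_of H (parts c)|%:R)); last by rewrite ler_pM2l.
      by rewrite -!natrM; apply: leq_natr.
    have : L%:R * X <= (12 * q%:R * eta) * X ^+ 2 * X.
      apply: (@le_trans _ _ (L%:R * (2 * q%:R * (n %/ q)%:R))); first by rewrite ler_wpM2l.
      rewrite mulrCA.
      have -> : 12 * q%:R * eta * X ^+ 2 * X = 2 * q%:R * (6 * (eta * X ^+ 3)) by ring.
      by rewrite ler_pM2l // mulr_gt0.
    rewrite ler_pM2r // => h2; apply: le_trans h2 _.
    by rewrite ler_wpM2r // exprn_ge0 // ltW.
  have h1 : L%:R * q%:R <= 2 * X ^+ 2.
    rewrite /X -natrX -!natrM; apply: leq_natr.
    have h3 : (n %/ q * q <= n)%N by apply: leq_trunc_div.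
    have h4 : (t.+2 * q <= n)%N by move: hn; clear; lia.
    apply: leq_trans (leq_mul hL (leqnn q)) _.
    by move: h3 h4; clear; nia.
  have h2 : 2 <= gam * q%:R by rewrite mulrC -ler_pdivrMr // ltW.
  rewrite -(ler_pM2r q0); apply: le_trans h1 _.
  have -> : gam * X ^+ 2 * q%:R = (gam * q%:R) * X ^+ 2 by ring.
  by rewrite ler_wpM2r // exprn_ge0 // ltW.
- have <- : (\sum_i #|parts c i| ^ 2)%:R = \sum_i v i ^+ 2.
    by rewrite natr_sum; apply: eq_bigr => i _; rewrite natrX.
  by rewrite -!natrX -!natrM -!natrD; apply: leq_natr.
- by rewrite -natrD; apply: leq_natr.
- by move: (leq_natr R hex); rewrite natrD !natrM.
- by move: X3; clear; lra.
- by rewrite /gam; move: eta1 e1_gt0; clear; lra.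
Qed.
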